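(* For any commutative ring $\mathbb{K}$ and any finite digraph $G$, there is an isomorphism of graded algebras between the path cochain algebra and the diagonal part of the magnitude cohomology algebra: $$\Omega^\bullet(G)\cong\mathrm{MH}^{\mathsf{diag}}(G).$$
   Context: A digraph $G$ consists of a set of vertices $V(G)$ and a set of arrows, which are ordered pairs of distinct vertices. A path of length $n\ge 0$ is a tuple of vertices $(p_0,\dots,p_n)$ such that each $(p_i,p_{i+1})$ is an arrow; $d(x,y)$ is the infimum of lengths of paths from $x$ to $y$ ($\infty$ if there are none). The path cochain algebra $\Omega^\bullet(G)=\Omega^\bullet(G,\mathbb{K})$: set $X=V(G)$, $\Lambda^n(X)=\mathrm{Hom}_{\mathbb{K}}(\mathbb{K}\cdot X^{n+1},\mathbb{K})$ with basis $e^{x_0,\dots,x_n}$ dual to the basis of $(n+1)$-tuples, and differential $\partial(e^{x_0,\dots,x_n})=\sum_{i=0}^{n+1}\sum_{v\in X}(-1)^ie^{x_0,\dots,x_{i-1},v,x_i,\dots,x_n}$. $\mathcal{R}^\bullet\subseteq\Lambda^\bullet(X)$ is the subcomplex with $\mathcal{R}^n$ spanned by the $e^{x_0,\dots,x_n}$ with $x_i\neq x_{i+1}$ for all $i$. It is a dg-algebra with product $e^{x_0,\dots,x_n}e^{y_0,\dots,y_m}=e^{x_0,\dots,x_{n-1},y_0,\dots,y_m}$ if $y_0=x_n$, and $0$ otherwise. Let $\mathcal{N}^n\subseteq\mathcal{R}^n$ be spanned by the $e^{x_0,\dots,x_n}$ such that $(x_0,\dots,x_n)$ is not a path of $G$,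 and let $\mathcal{J}$ be the dg-ideal with $\mathcal{J}^n=\mathcal{N}^n+\partial(\mathcal{N}^{n-1})$. Then $\Omega^\bullet(G)=\mathcal{R}^\bullet/\mathcal{J}$. Magnitude cohomology: put $|x_0,\dots,x_n|=\sum_{i=0}^{n-1}d(x_i,x_{i+1})$. $\mathrm{MC}_{n,\ell}(G)$ is the free $\mathbb{K}$-module on tuples of vertices with $x_i\neq x_{i+1}$ and $|x_0,\dots,x_n|=\ell$; the differential is $\sum_{i=0}^n(-1)^i\partial_{n,i}$, where $\partial_{n,i}$ deletes $x_i$ if the resulting tuple still has norm $\ell$ and is $0$ otherwise. $\mathrm{MC}^{\bullet,\ell}(G)=\mathrm{Hom}_{\mathbb{K}}(\mathrm{MC}_{\bullet,\ell}(G),\mathbb{K})$ and $\mathrm{MH}^{n,\ell}(G)=H^n(\mathrm{MC}^{\bullet,\ell}(G))$. The magnitude cohomology algebra (Hepworth) has the product $\mathrm{MH}^{n,\ell}(G)\otimes\mathrm{MH}^{m,k}(G)\to\mathrm{MH}^{n+m,\ell+k}(G)$ induced by $(\varphi\cdot\psi)(x_0,\dots,x_{n+m})=\varphi(x_0,\dots,x_n)\,\psi(x_n,\dots,x_{n+m})$, where a cochain is taken to be zero on tuples whose norm differs from its second degree. Its diagonal part is the graded algebra $\mathrm{MH}^{\mathsf{diag}}(G)=\bigoplus_n\mathrm{MH}^{n,n}(G)$. *)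

(* Defs.v *)
From HB Require Import structures.
From mathcomp Require Import all_boot all_order all_algebra.
From mathcomp Require Import boolp.

Set Implicit Arguments.
Unset Strict Implicit.
Unset Printing Implicit Defensive.

Import GRing.Theory.
Local Open Scope ring_scope.
Local Open Scope quotient_scope.

Lemma submodB (K : pzRingType) (V : lmodType K) (S : submodClosed V) :
  {in S &, forall u v, u - v \in S}.
Proof. by move=> u v uS vS; rewrite -scaleN1r rpredD ?rpredZ. Qed.

Section Subquotient.
Variables (K : pzRingType) (V : lmodType K) (Z B : submodClosed V).

Record submod := Submod { submod_val : V; submod_valP : submod_val \in Z }.
HB.instance Definition _ := [isSub for submod_val].
HB.instance Definition _ := [Choice of submod by <:].
HB.instance Definition _ := [SubChoice_isSubLmodule of submod by <:].

Definition denominator : {pred submod} := [pred z : submod | val z \in B].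

Fact denominator_zmod_closed : zmod_closed denominator.
Proof.
split=> [|x y]; rewrite !inE; first by rewrite raddf0 rpred0.
move=> xB yB; rewrite raddfB. exact: submodB.
Qed.
HB.instance Definition _ :=
  GRing.isZmodClosed.Build submod denominator denominator_zmod_closed.

(* The quotient of Z by its intersection with B, that is Z / B when B is       *)
(* contained in Z, as in all uses below.                                       *)
Definition subquot := Quotient.quot denominator.
HB.instance Definition _ := GRing.Zmodule.on subquot.
HB.instance Definition _ := EqQuotient.on subquot.

Definition class (z : submod) : subquot := \pi_subquot z.

Lemma eq_class (z w : submod) :
  (class z == class w) = (val z - val w \in B).
Proof.
by rewrite -[RHS]/(z - w \in denominator) Quotient.idealrBE.
Qed.

Lemma class_repr (x : subquot) : class (repr x) = x.
Proof. exact: reprK. Qed.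

Lemma classP (x : subquot) : exists z, x = class z.
Proof. by exists (repr x); rewrite class_repr. Qed.

Lemma repr_class (z : submod) : val (repr (class z)) - val z \in B.
Proof. by rewrite -eq_class class_repr. Qed.

Fact classB : {morph class : z w / z - w}.
Proof. by move=> z w; rewrite /class !piE. Qed.

Fact classD : {morph class : z w / z + w}.
Proof. by move=> z w; rewrite /class !piE. Qed.

Definition subquot_scale (a : K) (x : subquot) : subquot :=
  class (a *: repr x).

Fact class_scale a z : subquot_scale a (class z) = class (a *: z).
Proof.
by apply/eqP; rewrite eq_class /= -scalerBr rpredZ // repr_class.
Qed.

Fact subquot_scaleA a b x :
  subquot_scale a (subquot_scale b x) = subquot_scale (a * b) x.
Proof. by have [z ->] := classP x; rewrite !class_scale scalerA. Qed.

Fact subquot_scale1 : left_id 1 subquot_scale.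
Proof. by move=> x; have [z ->] := classP x; rewrite class_scale scale1r. Qed.

Fact subquot_scaleDr : right_distributive subquot_scale +%R.
Proof.
move=> a x y; have [[z ->] [w ->]] := (classP x, classP y).
by rewrite -classD !class_scale -classD scalerDr.
Qed.

Fact subquot_scaleDl x : {morph subquot_scale^~ x : a b / a + b}.
Proof.
by move=> a b; have [z ->] := classP x; rewrite !class_scale -classD scalerDl.
Qed.

HB.instance Definition _ := GRing.Zmodule_isLmodule.Build K subquot
  subquot_scaleA subquot_scale1 subquot_scaleDr subquot_scaleDl.

Fact class_linear : linear class.
Proof. by move=> a z w; rewrite classD -class_scale. Qed.
HB.instance Definition _ :=
  GRing.isLinear.Build K submod subquot _ class class_linear.

End Subquotient.

Definition bilinear_op (K : pzRingType) (U V W : lmodType K)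
    (m : U -> V -> W) : Prop :=
  (forall v, linear (m^~ v)) /\ (forall u, linear (m u)).

Section BilinearTheory.
Variables (K : pzRingType) (U V W : lmodType K) (m : U -> V -> W).
Hypothesis m_bil : bilinear_op m.

Lemma bilDl u u' v : m (u + u') v = m u v + m u' v.
Proof. by have := m_bil.1 v 1 u u'; rewrite !scale1r. Qed.
Lemma bilDr u v v' : m u (v + v') = m u v + m u v'.
Proof. by have := m_bil.2 u 1 v v'; rewrite !scale1r. Qed.
Lemma bil0l v : m 0 v = 0.
Proof. by apply: (addrI (m 0 v)); rewrite -bilDl !addr0. Qed.
Lemma bil0r u : m u 0 = 0.
Proof. by apply: (addrI (m u 0)); rewrite -bilDr !addr0. Qed.
Lemma bilZl a u v : m (a *: u) v = a *: m u v.
Proof. by have := m_bil.1 v a u 0; rewrite bil0l !addr0. Qed.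
Lemma bilZr a u v : m u (a *: v) = a *: m u v.
Proof. by have := m_bil.2 u a v 0; rewrite bil0r !addr0. Qed.
Lemma bilBl u u' v : m (u - u') v = m u v - m u' v.
Proof. by rewrite bilDl -scaleN1r bilZl scaleN1r. Qed.
Lemma bilBr u v v' : m u (v - v') = m u v - m u v'.
Proof. by rewrite bilDr -scaleN1r bilZr scaleN1r. Qed.

End BilinearTheory.

(* The product Z1/B1 x Z2/B2 -> Z3/B3 induced by m.  It is computed on         *)
(* representatives; induced_mulE is its independence of their choice.          *)
Section InducedProduct.
Variables (K : pzRingType) (V1 V2 V3 : lmodType K).
Variables (Z1 B1 : submodClosed V1) (Z2 B2 : submodClosed V2).
Variables (Z3 B3 : submodClosed V3) (m : V1 -> V2 -> V3).

Definition compatible : Prop :=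
  [/\ {in Z1 & Z2, forall x y, m x y \in Z3},
      {in B1 & Z2, forall x y, m x y \in B3}
    & {in Z1 & B2, forall x y, m x y \in B3}].

Hypothesis m_comp : compatible.

Fact induced_subproof (z : submod Z1) (w : submod Z2) :
  m (val z) (val w) \in Z3.
Proof. by case: m_comp => ZM _ _; apply: ZM; apply: valP. Qed.

Definition induced_mul (x : subquot Z1 B1) (y : subquot Z2 B2) :
    subquot Z3 B3 :=
  class B3 (Submod (induced_subproof (repr x) (repr y))).

Hypothesis m_bil : bilinear_op m.

Lemma induced_mulE z w :
  induced_mul (class B1 z) (class B2 w) =
  class B3 (Submod (induced_subproof z w)).
Proof.
apply/eqP; rewrite eq_class /=.
set z' := val (repr _); set w' := val (repr _).
have ->: m z' w' - m (val z) (val w) =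
    m (z' - val z) w' + m (val z) (w' - val w).
  by rewrite (bilBl m_bil) (bilBr m_bil) addrA subrK.
case: m_comp => _ BZ ZB.
rewrite rpredD //; first by apply: BZ; [apply: repr_class | apply: valP].
by apply: ZB; [apply: valP | apply: repr_class].
Qed.

Fact induced_mul_bilinear : bilinear_op induced_mul.
Proof.
split=> [y a x x' | x a y y'].
  have [[[z ->] [z' ->]] [w ->]] := (classP x, classP x', classP y).
  rewrite -linearP !induced_mulE -linearP; congr (class _ _); apply: val_inj.
  by rewrite /= (bilDl m_bil) (bilZl m_bil).
have [[[z ->] [w' ->]] [w ->]] := (classP x, classP y', classP y).
rewrite -linearP !induced_mulE -linearP; congr (class _ _); apply: val_inj.
by rewrite /= (bilDr m_bil) (bilZr m_bil).
Qed.

End InducedProduct.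

(* Associative unital graded algebras with components in degrees n >= 0.  The *)
(* casts only mediate between equal degrees, n + 0 = n and                    *)
(* n + (m + p) = n + m + p.                                                   *)
Record gradedAlg (K : comPzRingType) := GradedAlg {
  gcomp :> nat -> lmodType K;
  gone : gcomp 0%N;
  gmul : forall n m, gcomp n -> gcomp m -> gcomp (n + m)%N;
  gmul_bilinear : forall n m, bilinear_op (@gmul n m);
  gmul1x : forall n (x : gcomp n), gmul gone x = x;
  gmulx1 : forall n (x : gcomp n),
    ecast i (gcomp i : Type) (addn0 n) (gmul x gone) = x;
  gmulA : forall n m p (x : gcomp n) (y : gcomp m) (z : gcomp p),
    ecast i (gcomp i : Type) (addnA n m p) (gmul x (gmul y z))
      = gmul (gmul x y) z
}.

Definition graded_iso (K : comPzRingType) (A B : gradedAlg K) : Prop :=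
  exists f : forall n, {linear A n -> B n},
    [/\ forall n, bijective (f n),
        f 0%N (gone A) = gone B
      & forall n m (x : A n) (y : A m),
          f (n + m)%N (gmul x y) = gmul (f n x) (f m y)].

Section GradedSubquotient.
Variables (K : comPzRingType) (A : gradedAlg K).
Variables (Z B : forall n, submodClosed (A n)).
Hypothesis Z1 : gone A \in Z 0.
Hypothesis ZB : forall n m,
  compatible (Z n) (B n) (Z m) (B m) (Z (n + m)) (B (n + m)) (@gmul K A n m).

Definition gsub_one : subquot (Z 0) (B 0) := class (B 0) (Submod Z1).
Definition gsub_mul n m := induced_mul (@ZB n m).

Fact gsub_cast n m (e : n = m) (z : submod (Z n)) (w : submod (Z m)) :
  ecast i (A i : Type) e (val z) = val w ->
  ecast i (subquot (Z i) (B i) : Type) e (class (B n) z) = class (B m) w.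
Proof. by case: m / e w => w /= /val_inj ->. Qed.

Fact gsub_bilinear n m : bilinear_op (@gsub_mul n m).
Proof. exact/induced_mul_bilinear/gmul_bilinear. Qed.

Fact gsub_mul1x n (x : subquot (Z n) (B n)) : gsub_mul gsub_one x = x.
Proof.
have [z ->] := classP x; rewrite /gsub_mul induced_mulE; last first.
  exact: gmul_bilinear.
by congr class; apply: val_inj; rewrite /= gmul1x.
Qed.

Fact gsub_mulx1 n (x : subquot (Z n) (B n)) :
  ecast i (subquot (Z i) (B i) : Type) (addn0 n) (gsub_mul x gsub_one) = x.
Proof.
have [z ->] := classP x; rewrite /gsub_mul induced_mulE; last first.
  exact: gmul_bilinear.
by apply: gsub_cast; rewrite /= gmulx1.
Qed.

Fact gsub_mulA n m p (x : subquot (Z n) (B n)) (y : subquot (Z m) (B m))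
    (z : subquot (Z p) (B p)) :
  ecast i (subquot (Z i) (B i) : Type) (addnA n m p)
    (gsub_mul x (gsub_mul y z)) = gsub_mul (gsub_mul x y) z.
Proof.
have [[[u ->] [v ->]] [w ->]] := (classP x, classP y, classP z).
rewrite /gsub_mul !induced_mulE; do ?exact: gmul_bilinear.
by apply: gsub_cast; rewrite /= gmulA.
Qed.

Definition graded_subquot : gradedAlg K :=
  @GradedAlg K (fun n => subquot (Z n) (B n)) gsub_one gsub_mul
    gsub_bilinear gsub_mul1x gsub_mulx1 gsub_mulA.

End GradedSubquotient.

Record digraph := Digraph {
  vertex :> finType;
  arrow : rel vertex;
  arrow_irrefl : irreflexive arrow
}.

Section Tuples.
Variable V : Type.
Implicit Types n m l : nat.

(* x_i for x = (x_0, ..., x_n); only meaningful for i <= n. *)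
Definition vtx n (x : n.+1.-tuple V) (i : nat) : V := tnth x (inord i).

(* (x_s, ..., x_(s + l)); only meaningful for s + l <= n. *)
Definition segment n (s l : nat) (x : n.+1.-tuple V) : l.+1.-tuple V :=
  [tuple vtx x (s + i) | i < l.+1].

(* (x_0, ..., x_(i-1), v, x_i, ..., x_n) *)
Definition insert n (i : 'I_n.+2) (v : V) (x : n.+1.-tuple V) :
    n.+2.-tuple V :=
  [tuple if unlift i j is Some k then tnth x k else v | j < n.+2].

(* (x_0, ..., x_(i-1), x_(i+1), ..., x_(n+1)) *)
Definition delete n (i : 'I_n.+2) (x : n.+2.-tuple V) : n.+1.-tuple V :=
  [tuple tnth x (lift i j) | j < n.+1].

(* (x_0, ..., x_(n-1), y_0, ..., y_m) *)
Definition glue n m (x : n.+1.-tuple V) (y : m.+1.-tuple V) :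
    (n + m).+1.-tuple V :=
  [tuple if (i < n)%N then vtx x i else vtx y (i - n) | i < (n + m).+1].

Lemma eq_vtx n (x y : n.+1.-tuple V) :
  (forall i, (i <= n)%N -> vtx x i = vtx y i) -> x = y.
Proof.
move=> xy; apply: eq_from_tnth => i; have := xy i (leq_ord i).
by rewrite /vtx inord_val.
Qed.

Lemma vtx_mktuple n (F : 'I_n.+1 -> V) i :
  vtx [tuple F j | j < n.+1] i = F (inord i).
Proof. by rewrite /vtx tnth_mktuple. Qed.

Lemma vtx_segment n s l (x : n.+1.-tuple V) i :
  (i <= l)%N -> vtx (segment s l x) i = vtx x (s + i).
Proof. by move=> il; rewrite vtx_mktuple inordK. Qed.

Lemma vtx_delete n (i : 'I_n.+2) (x : n.+2.-tuple V) j :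
  (j <= n)%N -> vtx (delete i x) j = vtx x (bump i j).
Proof.
move=> jn; rewrite vtx_mktuple /vtx; congr tnth; apply: val_inj.
rewrite /= !inordK //.
by rewrite /bump; case: (i <= j)%N => //; apply: leqW.
Qed.

Lemma vtx_glue n m (x : n.+1.-tuple V) (y : m.+1.-tuple V) i :
  (i <= n + m)%N ->
  vtx (glue x y) i = if (i < n)%N then vtx x i else vtx y (i - n).
Proof. by move=> il; rewrite vtx_mktuple inordK. Qed.

Lemma vtx_cast n m (e : n = m) (x : n.+1.-tuple V) i :
  vtx (tcast (congr1 S e) x) i = vtx x i.
Proof. by case: m / e; rewrite tcast_id. Qed.

Lemma segment_id n (x : n.+1.-tuple V) : segment 0 n x = x.
Proof. by apply: eq_vtx => i ni; rewrite vtx_segment. Qed.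

Lemma segment_segment n s l s' l' (x : n.+1.-tuple V) : (s' + l' <= l)%N ->
  segment s' l' (segment s l x) = segment (s + s') l' x.
Proof.
move=> h; apply: eq_vtx => i il; rewrite !vtx_segment ?addnA //.
by apply: leq_trans h; rewrite leq_add2l.
Qed.

Lemma segment_cast n m (e : n = m) s l (x : n.+1.-tuple V) :
  segment s l (tcast (congr1 S e) x) = segment s l x.
Proof. by case: m / e; rewrite tcast_id. Qed.

Lemma glue_segment n m (z : (n + m).+1.-tuple V) :
  glue (segment 0 n z) (segment n m z) = z.
Proof.
apply: eq_vtx => i il; rewrite vtx_glue //; case: ltnP => h.
  by rewrite vtx_segment // ltnW.
by rewrite vtx_segment ?subnKC // leq_subLR.
Qed.

Lemma segment_gluel n m (x : n.+1.-tuple V) (y : m.+1.-tuple V) :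
  vtx x n = vtx y 0 -> segment 0 n (glue x y) = x.
Proof.
move=> xy; apply: eq_vtx => i il; rewrite vtx_segment // vtx_glue; last first.
  by rewrite add0n (leq_trans il) ?leq_addr.
rewrite add0n; case: ltnP => // ni; have <-: n = i by apply/eqP; rewrite eqn_leq ni.
by rewrite subnn xy.
Qed.

Lemma segment_gluer n m (x : n.+1.-tuple V) (y : m.+1.-tuple V) :
  segment n m (glue x y) = y.
Proof.
apply: eq_vtx => i il; rewrite vtx_segment // vtx_glue ?leq_add2l //.
by rewrite ltnNge leq_addr /= addKn.
Qed.

Lemma delete_insert n (i : 'I_n.+2) v (x : n.+1.-tuple V) :
  delete i (insert i v x) = x.
Proof. by apply: eq_from_tnth => j; rewrite !tnth_mktuple liftK. Qed.

Lemma insert_delete n (i : 'I_n.+2) (z : n.+2.-tuple V) :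
  insert i (tnth z i) (delete i z) = z.
Proof.
apply: eq_from_tnth => j; rewrite !tnth_mktuple.
by case: unliftP => [k ->|->] //; rewrite tnth_mktuple.
Qed.

Lemma tnth_insert n (i : 'I_n.+2) v (x : n.+1.-tuple V) :
  tnth (insert i v x) i = v.
Proof. by rewrite tnth_mktuple unlift_none. Qed.

End Tuples.

Section FreeModule.
Variables (K : comPzRingType) (T : finType).

(* The free module on T, with its standard basis and the extension by         *)
(* linearity of a map defined on that basis.                                  *)
Definition freemod := {ffun T -> K^o}.
HB.instance Definition _ := GRing.Lmodule.on freemod.

Definition basis (x : T) : freemod := [ffun y => (x == y)%:R].

Definition linext (W : lmodType K) (F : T -> W) (c : freemod) : W :=
  \sum_x (c x : K) *: F x.

(* The submodule spanned by the basis elements indexed by P. *)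
Definition span (P : pred T) : {pred freemod} :=
  [pred f | `[< exists c : T -> K, f = \sum_(x | P x) c x *: basis x >]].

Lemma freemod0 x : (0 : freemod) x = 0.
Proof. by rewrite ffunE. Qed.

Lemma linext_basis (W : lmodType K) (F : T -> W) x : linext F (basis x) = F x.
Proof.
rewrite /linext (bigD1 x) //= big1 ?ffunE ?eqxx ?scale1r ?addr0 // => y.
by rewrite ffunE eq_sym => /negPf ->; rewrite scale0r.
Qed.

Fact linext_linear (W : lmodType K) (F : T -> W) : linear (linext F).
Proof.
move=> a c d; rewrite /linext scaler_sumr -big_split; apply: eq_bigr => x _.
by rewrite !ffunE scalerDl scalerA.
Qed.

Lemma spanP (P : pred T) (f : freemod) :
  reflect (forall x, ~~ P x -> f x = 0) (f \in span P).
Proof.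
apply: (iffP (asboolP _)) => [[c ->] x nPx|f0].
  rewrite sum_ffunE big1 // => y Py; rewrite !ffunE.
  by case: eqP nPx Py => [->|_ _ _]; [move/negPf-> | exact: mulr0].
exists f; apply/ffunP => x; rewrite sum_ffunE.
have [Px|nPx] := boolP (P x).
  rewrite (bigD1 x) //= !ffunE eqxx big1 ?addr0.
    by rewrite [_ *: _]mulr1.
  by move=> y /andP[_ /negPf yx]; rewrite !ffunE yx [_ *: _]mulr0.
rewrite f0 // big1 // => y Py; rewrite !ffunE.
by case: eqP nPx Py => [->|_ _ _]; [move/negPf-> | exact: mulr0].
Qed.

Fact span_closed P : subsemimod_closed (span P).
Proof.
split; first split.
- by apply/spanP => x _; rewrite ffunE.
- move=> f g /spanP f0 /spanP g0; apply/spanP => x Px.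
  by rewrite ffunE f0 // g0 // addr0.
- move=> a f /spanP f0; apply/spanP => x Px.
  by rewrite ffunE f0 // scaler0.
Qed.
HB.instance Definition _ (W : lmodType K) (F : T -> W) :=
  GRing.isLinear.Build K freemod W _ (linext F) (linext_linear F).
HB.instance Definition _ P :=
  GRing.isSubmodClosed.Build K freemod (span P) (span_closed P).

End FreeModule.

Section PathCochains.
Variables (K : comPzRingType) (G : digraph).
Implicit Types n m : nat.

Definition regular n (x : n.+1.-tuple G) : bool :=
  [forall i : 'I_n, vtx x i != vtx x i.+1].

Definition is_path n (x : n.+1.-tuple G) : bool :=
  [forall i : 'I_n, arrow (vtx x i) (vtx x i.+1)].

(* Lambda^n; as the vertex set is finite, Hom(K.X^(n+1), K) has the dual basis *)
(* e^(x_0, ..., x_n), which is [basis x] below.                                *)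
Local Notation Lambda n := (freemod K (n.+1.-tuple G)).

Definition Ldiff n (f : Lambda n) : Lambda n.+1 :=
  linext (fun x : n.+1.-tuple G =>
    \sum_(i < n.+2) \sum_(v : G) (-1) ^+ i *: basis K (insert i v x)) f.

Definition Lmul n m (f : Lambda n) (g : Lambda m) : Lambda (n + m)%N :=
  linext (fun x : n.+1.-tuple G =>
    linext (fun y : m.+1.-tuple G =>
      if vtx y 0 == vtx x n then basis K (glue x y) else 0) g) f.

Definition Lone : Lambda 0%N := \sum_(v : G) basis K [tuple v].

Definition Rsub n : submodClosed (Lambda n) := span (@regular n).

Definition Nsub n : submodClosed (Lambda n) :=
  span (fun x : n.+1.-tuple G => regular x && ~~ is_path x).

(* J^n = N^n + Ldiff(N^(n-1)), with N^(-1) = 0 *)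
Definition Jpred n : {pred Lambda n} :=
  match n return {pred Lambda n} with
  | 0 => [pred f | f \in Nsub 0]
  | k.+1 => [pred f | `[< exists a b,
      [/\ a \in Nsub k.+1, b \in Nsub k & f = a + Ldiff b] >]]
  end.

Lemma LdiffE n (f : Lambda n) z :
  Ldiff f z = \sum_(i < n.+2) (-1) ^+ i * (f (delete i z) : K).
Proof.
rewrite /Ldiff /linext sum_ffunE.
transitivity (\sum_(x : n.+1.-tuple G) \sum_(i < n.+2) \sum_(v : G)
    (f x : K) * ((-1) ^+ i * (insert i v x == z)%:R)).
  apply: eq_bigr => x _; rewrite ffunE sum_ffunE scaler_sumr.
  apply: eq_bigr => i _; rewrite sum_ffunE scaler_sumr.
  by apply: eq_bigr => v _; rewrite !ffunE.
rewrite exchange_big; apply: eq_bigr => i _.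
rewrite (bigD1 (delete i z)) //= (bigD1 (tnth z i)) //= insert_delete eqxx.
rewrite mulr1 mulrC big1 ?addr0 => [|v /eqP vz].
  rewrite big1 ?addr0 // => x /eqP xz; rewrite big1 // => v _.
  by case: eqP => [zE|_]; rewrite ?mulr0 //; case: xz; rewrite -zE delete_insert.
case: eqP => [zE|_]; rewrite ?mulr0 //; case: vz.
by rewrite -[in RHS]zE tnth_insert.
Qed.

Lemma LmulE n m (f : Lambda n) (g : Lambda m) z :
  Lmul f g z = (f (segment 0 n z) : K) * g (segment n m z).
Proof.
rewrite /Lmul /linext sum_ffunE (bigD1 (segment 0 n z)) //= ffunE.
rewrite sum_ffunE (bigD1 (segment n m z)) //= ffunE.
have vE : vtx (segment n m z) 0 == vtx (segment 0 n z) n.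
  by rewrite !vtx_segment // add0n addn0.
rewrite vE glue_segment ffunE eqxx [(g _ : K) *: _]mulr1.
rewrite big1 ?addr0 => [|y /eqP yz].
  rewrite big1 ?addr0 // => x /eqP xz; rewrite ffunE sum_ffunE big1 ?scaler0 //.
  move=> y _; rewrite ffunE; case: eqP => [xy|]; last by rewrite ffunE scaler0.
  rewrite ffunE; case: eqP => [zE|]; last by rewrite scaler0.
  by case: xz; rewrite -zE segment_gluel.
rewrite ffunE; case: eqP => [xy|]; last by rewrite ffunE scaler0.
rewrite ffunE; case: eqP => [zE|]; last by rewrite scaler0.
by case: yz; rewrite -zE segment_gluer.
Qed.

Lemma LoneE z : Lone z = 1.
Proof.
rewrite /Lone sum_ffunE (bigD1 (vtx z 0)) //= big1 ?addr0 => [|v].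
  rewrite ffunE (_ : _ == _ = true) //; apply/eqP/eq_vtx => i.
  by rewrite leqn0 => /eqP->; rewrite /vtx (tnth_nth (vtx z 0)) inordK.
move=> vz; rewrite ffunE; case: eqP => // zE; case/eqP: vz.
by rewrite -zE /vtx (tnth_nth v) inordK.
Qed.

Lemma Ldiff_linear n : linear (@Ldiff n).
Proof. exact: linext_linear. Qed.

Lemma Lmul_bilinear n m : bilinear_op (@Lmul n m).
Proof.
by split=> [g a f f' | f a g g']; apply/ffunP=> z;
  rewrite LmulE [in RHS]ffunE [in RHS]ffunE !LmulE !ffunE ?mulrDl ?mulrDr //;
  rewrite /GRing.scale /= ?mulrA // [f _ * a]mulrC.
Qed.

Lemma Lcast n m (e : n = m) (f : Lambda n) z :
  (ecast i (Lambda i) e f) z = f (tcast (congr1 S (esym e)) z).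
Proof. by case: m / e z => z; rewrite tcast_id. Qed.

Lemma Lmul1x n (f : Lambda n) : Lmul Lone f = f.
Proof. by apply/ffunP=> z; rewrite LmulE LoneE mul1r segment_id. Qed.

Lemma Lmulx1 n (f : Lambda n) :
  ecast i (Lambda i) (addn0 n) (Lmul f Lone) = f.
Proof.
apply/ffunP=> z; rewrite Lcast LmulE LoneE mulr1 segment_cast.
by rewrite segment_id.
Qed.

Lemma LmulA n m p (f : Lambda n) (g : Lambda m) (h : Lambda p) :
  ecast i (Lambda i) (addnA n m p) (Lmul f (Lmul g h)) = Lmul (Lmul f g) h.
Proof.
apply/ffunP=> z; rewrite Lcast !LmulE !segment_cast mulrA.
by rewrite !segment_segment ?add0n ?leq_addr // addn0.
Qed.

Let del n (i : nat) (x : n.+2.-tuple G) : n.+1.-tuple G :=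
  [tuple vtx x (bump i j) | j < n.+1].

Let delE n (i : 'I_n.+2) (x : n.+2.-tuple G) : delete i x = del i x.
Proof.
by apply: eq_vtx => j jn; rewrite vtx_delete // vtx_mktuple inordK.
Qed.

Let vtx_del n i (x : n.+2.-tuple G) j :
  (j <= n)%N -> vtx (del i x) j = vtx x (bump i j).
Proof. by move=> jn; rewrite vtx_mktuple inordK. Qed.

Let LdiffnE n (f : Lambda n) z :
  Ldiff f z = \sum_(0 <= i < n.+2) (-1) ^+ i * (f (del i z) : K).
Proof. by rewrite LdiffE big_mkord; apply: eq_bigr => i _; rewrite delE. Qed.

Lemma Ldiff_mul n m (f : Lambda n) (g : Lambda m) (z : (n + m).+2.-tuple G) :
  Ldiff (Lmul f g) z =
    (Ldiff f (segment 0 n.+1 z) : K) * g (segment n.+1 m z)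
    + (-1) ^+ n * ((f (segment 0 n z) : K) * Ldiff g (segment n m.+1 z)).
Proof.
have bump_le a b c : (a <= c)%N -> (bump b a <= c.+1)%N.
  by move=> ac; rewrite /bump; case: (b <= a)%N => //; apply: leqW.
rewrite !LdiffnE (@big_cat_nat _ _ _ n.+1) //=; last by rewrite ltnS leqW ?leq_addr.
rewrite (big_nat_recr n.+1) //= mulrDl mulr_suml.
rewrite [in X in _ = _ + X](big_nat_recl m.+1) //= expr0 mul1r.
have ->: del n.+1 (segment 0 n.+1 z) = segment 0 n z.
  apply: eq_vtx => i il; rewrite vtx_del // !vtx_segment ?bump_le //.
  by rewrite /bump ltnNge il.
have ->: del 0 (segment n m.+1 z) = segment n.+1 m z.
  apply: eq_vtx => i il; rewrite vtx_del // !vtx_segment ?bump_le //.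
  by rewrite /bump /= addnA addn1.
set a : K := f _; set b : K := g _.
rewrite !mulrDr -addrA [X in _ = _ + X]addrA.
have ->: (-1) ^+ n.+1 * a * b + (-1) ^+ n * (a * b) = 0.
  by rewrite exprS mulN1r !mulNr mulrA addNr.
rewrite add0r; congr (_ + _).
  rewrite !big_mkord; apply: eq_bigr => -[i /= ltin] _; rewrite LmulE mulrA.
  congr (_ * (f _ : K) * g _); apply: eq_vtx => j jl.
    rewrite vtx_segment // !vtx_del ?vtx_segment ?bump_le //.
    by rewrite (leq_trans jl) ?leq_addr.
  rewrite !vtx_segment // vtx_del ?leq_add2l //.
  by rewrite /bump (leq_trans _ (leq_addr j n)) // addnA add1n.
rewrite -{1}[n.+1]add0n big_addn.
have ->: ((n + m).+2 - n.+1 = m.+1)%N by rewrite subSS -addnS addKn.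
rewrite !big_mkord !mulr_sumr; apply: eq_bigr => -[i /= ltim] _.
rewrite LmulE addnC addSnnS exprD -!mulrA; congr (_ * _).
rewrite mulrCA.
have seg1: segment 0 n (del (n + i.+1) z) = segment 0 n z.
  apply: eq_vtx => j jl; rewrite !vtx_segment // vtx_del; last first.
    by rewrite (leq_trans jl) ?leq_addr.
  by rewrite /bump leqNgt addnS ltnS (leq_trans jl) ?leq_addr.
have seg2: segment n m (del (n + i.+1) z) = del i.+1 (segment n m.+1 z).
  apply: eq_vtx => j jl; rewrite vtx_del // !vtx_segment ?bump_le //.
  rewrite vtx_del ?leq_add2l //; congr vtx.
  by rewrite /bump leq_add2l addnCA.
by rewrite seg1 seg2.
Qed.

Lemma Lmul_eq0 n m (f : Lambda n) (g : Lambda m) z :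
  f (segment 0 n z) = 0 \/ g (segment n m z) = 0 -> Lmul f g z = 0.
Proof. by rewrite LmulE => -[] ->; rewrite ?mul0r ?mulr0. Qed.

Lemma vtx_allP (P : rel G) n (x : n.+1.-tuple G) :
  reflect (forall i, (i < n)%N -> P (vtx x i) (vtx x i.+1))
    [forall i : 'I_n, P (vtx x i) (vtx x i.+1)].
Proof.
apply: (iffP forallP) => [Px i ltin | Px i]; last exact: Px.
exact: (Px (Ordinal ltin)).
Qed.

Lemma vtx_all_cat (P : rel G) n m (z : (n + m).+1.-tuple G) :
  [forall i : 'I_(n + m), P (vtx z i) (vtx z i.+1)] =
  [forall i : 'I_n, P (vtx (segment 0 n z) i) (vtx (segment 0 n z) i.+1)] &&
  [forall i : 'I_m, P (vtx (segment n m z) i) (vtx (segment n m z) i.+1)].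
Proof.
apply/vtx_allP/andP=> [Pz | [/vtx_allP P1 /vtx_allP P2] i ltinm].
  split; apply/vtx_allP => i lti; rewrite !vtx_segment ?(ltnW lti) //.
    by apply: Pz; rewrite (leq_trans lti) ?leq_addr.
  by rewrite addnS; apply: Pz; rewrite ltn_add2l.
have [lti | lein] := ltnP i n.
  by have := P1 i lti; rewrite !vtx_segment // ltnW.
have lti : (i - n < m)%N by rewrite ltn_subLR.
have := P2 _ lti; rewrite !vtx_segment //; last exact: ltnW.
by rewrite addnS subnKC.
Qed.

Lemma regular_cat n m (z : (n + m).+1.-tuple G) :
  regular z = regular (segment 0 n z) && regular (segment n m z).
Proof. exact: (vtx_all_cat (fun u v => u != v)). Qed.

Lemma is_path_cat n m (z : (n + m).+1.-tuple G) :
  is_path z = is_path (segment 0 n z) && is_path (segment n m z).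
Proof. exact: (vtx_all_cat (@arrow G)). Qed.

Lemma Lone_R : Lone \in Rsub 0.
Proof. by apply/spanP => z /forallPn[[]]. Qed.

Lemma Lmul_R n m (f : Lambda n) (g : Lambda m) :
  f \in Rsub n -> g \in Rsub m -> Lmul f g \in Rsub (n + m).
Proof.
move=> /spanP Rf /spanP Rg; apply/spanP => z.
by rewrite regular_cat negb_and => /orP[/Rf|/Rg] h; apply: Lmul_eq0; [left|right].
Qed.

Lemma Nsub_R n (f : Lambda n) : f \in Nsub n -> f \in Rsub n.
Proof. by move=> /spanP Nf; apply/spanP => z /negPf nz; rewrite Nf // nz. Qed.

Lemma Lmul_NR n m (f : Lambda n) (g : Lambda m) :
  f \in Nsub n -> g \in Rsub m -> Lmul f g \in Nsub (n + m).
Proof.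
move=> /spanP Nf /spanP Rg; apply/spanP => z h; apply: Lmul_eq0.
have [g0|g_reg] := boolP (regular (segment n m z)); last by right; apply: Rg.
left; apply: Nf; apply: contra h => /andP[f0 f1].
by rewrite regular_cat f0 g0 is_path_cat negb_and f1.
Qed.

Lemma Lmul_RN n m (f : Lambda n) (g : Lambda m) :
  f \in Rsub n -> g \in Nsub m -> Lmul f g \in Nsub (n + m).
Proof.
move=> /spanP Rf /spanP Ng; apply/spanP => z h; apply: Lmul_eq0.
have [f0|f_reg] := boolP (regular (segment 0 n z)); last by left; apply: Rf.
right; apply: Ng; apply: contra h => /andP[g0 g1].
by rewrite regular_cat f0 g0 is_path_cat negb_and g1 orbT.
Qed.

(* R is a subcomplex of Lambda. *)
Lemma Ldiff_R n (f : Lambda n) : f \in Rsub n -> Ldiff f \in Rsub n.+1.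
Proof.
move=> /spanP Rf; apply/spanP => z /forallPn[j]; rewrite negbK => /eqP zj.
have ltj := ltn_ord j; rewrite LdiffnE big_mkord.
have ltj1 : (j < n.+2)%N by rewrite ltnW.
rewrite (bigD1 (Ordinal ltj1)) // (bigD1 (Ordinal (ltj : j.+1 < n.+2)%N)) /=;
  last by rewrite -val_eqE /= gtn_eqF.
have ->: del j.+1 z = del j z.
  apply: eq_vtx => k kn; rewrite !vtx_del // /bump.
  by case: (ltngtP j k) => // <-.
rewrite exprS mulN1r mulNr addrA subrr add0r big1 // => i /andP[].
rewrite -!val_eqE /= => ij ij1; rewrite Rf ?mulr0 //; apply/forallPn.
have ltin := ltn_ord i.
have [lt_ji | le_ij] := ltnP j i.
  have lt_j1i : (j.+1 < i)%N by rewrite ltn_neqAle eq_sym ij1.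
  have jn : (j < n)%N by rewrite -ltnS (leq_trans lt_j1i).
  exists (Ordinal jn); rewrite negbK /= !vtx_del ?(ltnW jn) //.
  have [-> ->]: bump i j = j /\ bump i j.+1 = j.+1.
    by rewrite /bump !(leqNgt i _) lt_ji lt_j1i.
  by rewrite zj.
have lt_ij : (i < j)%N by rewrite ltn_neqAle ij.
have jn : (j.-1 < n)%N by rewrite -ltnS prednK // (leq_ltn_trans _ lt_ij).
have jE : j = j.-1.+1 :> nat by rewrite prednK // (leq_ltn_trans _ lt_ij).
exists (Ordinal jn); rewrite negbK /= !vtx_del ?(ltnW jn) //.
have [-> ->]: bump i j.-1 = j /\ bump i j.-1.+1 = j.+1.
  by rewrite -jE /bump le_ij -ltnS -jE lt_ij !add1n -jE.
by rewrite zj.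
Qed.

Fact Jpred_closed n : subsemimod_closed (@Jpred n).
Proof.
case: n => [|n]; first by split; [exact: (@rpred0D _ (Nsub 0)) | exact: (@rpredZ _ _ (Nsub 0))].
split; first split.
- apply/asboolP; exists 0, 0; rewrite !rpred0; split=> //.
  by rewrite add0r /Ldiff (raddf0 (linext _)).
- move=> _ _ /asboolP[a [b [aN bN ->]]] /asboolP[c [d [cN dN ->]]].
  apply/asboolP; exists (a + c), (b + d); rewrite !rpredD //; split=> //.
  by rewrite -[b]scale1r Ldiff_linear !scale1r addrACA.
- move=> k _ /asboolP[a [b [aN bN ->]]].
  apply/asboolP; exists (k *: a), (k *: b); rewrite !rpredZ //; split=> //.
  by rewrite scalerDr /Ldiff linearZ.
Qed.
HB.instance Definition _ n :=
  GRing.isSubmodClosed.Build K (Lambda n) (@Jpred n) (@Jpred_closed n).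

Definition Jsub n : submodClosed (Lambda n) := @Jpred n.

Lemma Lmul_castE n m N (e : N = (n + m)%N) (f : Lambda n) (g : Lambda m)
    (z : N.+1.-tuple G) :
  (f (segment 0 n z) : K) * g (segment n m z) =
  Lmul f g (tcast (congr1 S e) z).
Proof. by rewrite LmulE !segment_cast. Qed.

Lemma Nsub_cast0 n N (e : N = n) (f : Lambda n) (z : N.+1.-tuple G) :
  f \in Nsub n -> ~~ (regular z && ~~ is_path z) ->
  f (tcast (congr1 S e) z) = 0.
Proof. by case: n / e f => f /spanP Nf /Nf; rewrite tcast_id. Qed.

Lemma Jsub_R n (f : Lambda n) : f \in Jsub n -> f \in Rsub n.
Proof.
case: n f => [|n] f; first exact: Nsub_R.
move=> /asboolP[a [b [Na Nb ->]]].
by apply: (@rpredD _ (Rsub n.+1)); [exact: Nsub_R | exact/Ldiff_R/Nsub_R].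
Qed.

Lemma Nsub_J n (f : Lambda n) : f \in Nsub n -> f \in Jsub n.
Proof.
case: n f => [//|n] f Nf; apply/asboolP; exists f, 0.
by rewrite Nf rpred0 /Ldiff linear0 addr0.
Qed.

Lemma Jsub_intro n N (e : N = n.+1) (f : Lambda N) (b : Lambda n) :
  b \in Nsub n ->
  (forall z, ~~ (regular z && ~~ is_path z) ->
     f z = Ldiff b (tcast (congr1 S e) z)) ->
  f \in Jsub N.
Proof.
subst N => Nb fb; apply/asboolP.
exists (f - Ldiff b), b; split=> //; last by rewrite subrK.
by apply/spanP => z Nz; rewrite !ffunE fb // tcast_id subrr.
Qed.

(* J is a two-sided ideal of R. *)
Lemma Lmul_compatible n m :
  compatible (Rsub n) (Jsub n) (Rsub m) (Jsub m) (Rsub (n + m)) (Jsub (n + m))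
    (@Lmul n m).
Proof.
split=> f g; first exact: Lmul_R.
  case: n f => [|n] f; first by move=> Nf Rg; apply/Nsub_J/Lmul_NR.
  move=> /asboolP[a [b [Na Nb ->]]] Rg.
  apply: (@Jsub_intro (n + m) (n.+1 + m) erefl _ (Lmul b g)).
    exact: Lmul_NR.
  move=> z Nz; rewrite tcast_id (bilDl (@Lmul_bilinear _ _)) ffunE.
  have /spanP-> // := Lmul_NR Na Rg; rewrite add0r Ldiff_mul LmulE.
  rewrite (Lmul_castE (esym (addnS n m))) Nsub_cast0 ?mulr0 ?addr0 //.
  exact/Lmul_NR/Ldiff_R.
case: m g => [|m] g; first by move=> Rf Ng; apply/Nsub_J/Lmul_RN.
move=> Rf /asboolP[a [b [Na Nb ->]]].
apply: (@Jsub_intro _ _ (addnS n m) _ ((-1) ^+ n *: Lmul f b)).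
  by rewrite rpredZ // Lmul_RN.
move=> z Nz; rewrite (bilDr (@Lmul_bilinear _ _)) ffunE.
have /spanP-> // := Lmul_RN Rf Na; rewrite add0r LmulE.
rewrite /Ldiff linearZ ffunE -/(Ldiff _) Ldiff_mul.
rewrite [_ *: _]mulrDr signrMK !segment_cast.
rewrite (Lmul_castE (addnS n m : _ = n.+1 + m)%N) Nsub_cast0 ?mulr0 ?add0r //.
exact/Lmul_RN/Nb/Ldiff_R.
Qed.

Definition Lambda_alg : gradedAlg K :=
  @GradedAlg K (fun n => Lambda n) Lone Lmul Lmul_bilinear
    Lmul1x Lmulx1 LmulA.

Definition Omega : gradedAlg K :=
  @graded_subquot K Lambda_alg Rsub Jsub Lone_R Lmul_compatible.

End PathCochains.

(* Addition on nat extended by infinity, which is None. *)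
Definition addoo (a b : option nat) : option nat :=
  if (a, b) is (Some i, Some j) then Some (i + j)%N else None.

Fact addooA : associative addoo.
Proof. by move=> [i|] [j|] [k|] //=; rewrite /addoo addnA. Qed.
Fact addooC : commutative addoo.
Proof. by move=> [i|] [j|] //=; rewrite /addoo addnC. Qed.
Fact add0oo : left_id (Some 0%N) addoo.
Proof. by case. Qed.
HB.instance Definition _ :=
  Monoid.isComLaw.Build (option nat) (Some 0%N) addoo addooA addooC add0oo.

Section MagnitudeCochains.
Variables (K : comPzRingType) (G : digraph).
Implicit Types n m l k : nat.

Definition joined (x y : G) (n : nat) : bool :=
  [exists p : n.+1.-tuple G, [&& is_path p, vtx p 0 == x & vtx p n == y]].

(* d(x, y), with None for infinity *)
Definition dist (x y : G) : option nat :=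
  if pselect (exists n, joined x y n) is left ex then Some (ex_minn ex)
  else None.

Definition norm n (x : n.+1.-tuple G) : option nat :=
  \big[addoo/Some 0%N]_(i < n) dist (vtx x i) (vtx x i.+1).

Definition generator n l :=
  {x : n.+1.-tuple G | regular x && (norm x == Some l)}.

Definition chain n l := freemod K (generator n l).

(* The requirement of [regular] built in [insub] is redundant here: deleting  *)
(* a vertex between two equal ones decreases the norm.                        *)
Definition face n l (i : 'I_n.+2) (x : generator n.+1 l) : chain n l :=
  if insub (delete i (val x)) is Some y then basis K y else 0.

Definition chain_diff n l : chain n.+1 l -> chain n l :=
  linext (fun x => \sum_(i < n.+2) (-1) ^+ i *: face i x).

(* MC^(n, l) = Hom(MC_(n, l), K): a linear form is given by its values on the basis, and  *)
(* its value on c is [linext phi c].                                          *)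
Definition cochain n l := freemod K (generator n l).

Definition cochain_diff n l (phi : cochain n l) : cochain n.+1 l :=
  [ffun x => linext phi (chain_diff (basis K x))].

Definition extend0 n l (phi : cochain n l) : freemod K (n.+1.-tuple G) :=
  [ffun x => if insub x is Some y then phi y else 0].

Definition cochain_mul n l m k (phi : cochain n l) (psi : cochain m k) :
    cochain (n + m) (l + k) :=
  [ffun x : generator (n + m) (l + k) =>
    (extend0 phi (segment 0 n (val x)) : K)
      * extend0 psi (segment n m (val x))].

Definition cochain_one : cochain 0 0 := [ffun=> 1].

Definition cocyclep n l : {pred cochain n l} :=
  [pred phi | cochain_diff phi == 0].

Definition coboundaryp n l : {pred cochain n l} :=
  match n return {pred cochain n l} with
  | 0 => pred1 0
  | p.+1 => [pred phi | `[< exists psi, phi = @cochain_diff p l psi >]]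
  end.

Lemma extend0_val n l (phi : cochain n l) (x : generator n l) :
  extend0 phi (val x) = phi x.
Proof. by rewrite ffunE valK. Qed.

Lemma extend0_out n l (phi : cochain n l) x :
  ~~ (regular x && (norm x == Some l)) -> extend0 phi x = 0.
Proof. by move=> nx; rewrite ffunE insubN. Qed.

Lemma cochain_diffE n l (phi : cochain n l) x :
  cochain_diff phi x = Ldiff (extend0 phi) (val x).
Proof.
rewrite ffunE /chain_diff linext_basis linear_sum LdiffE.
apply: eq_bigr => i _; rewrite linearZ; congr (_ * _).
rewrite /face ffunE; case: insub => [y|]; last exact: linear0.
exact: linext_basis.
Qed.

Lemma regular_cast n m (e : n = m) (x : n.+1.-tuple G) :
  regular (tcast (congr1 S e) x) = regular x.
Proof. by case: m / e; rewrite tcast_id. Qed.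

Lemma norm_cast n m (e : n = m) (x : n.+1.-tuple G) :
  norm (tcast (congr1 S e) x) = norm x.
Proof. by case: m / e; rewrite tcast_id. Qed.

Lemma norm_cat n m (z : (n + m).+1.-tuple G) :
  norm z = addoo (norm (segment 0 n z)) (norm (segment n m z)).
Proof.
rewrite /norm big_split_ord; congr addoo; apply: eq_bigr => i _.
  by rewrite !vtx_segment // ltnW.
by rewrite !vtx_segment ?addnS // ltnW.
Qed.

Lemma extend0_mul n l m k (phi : cochain n l) (psi : cochain m k) :
  extend0 (cochain_mul phi psi) = Lmul (extend0 phi) (extend0 psi).
Proof.
apply/ffunP => z; have [zT|zT] := boolP (regular z && (norm z == Some (l + k)%N)).
  have -> : z = val (exist _ z zT : generator _ _) by [].
  by rewrite extend0_val ffunE LmulE.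
rewrite extend0_out //; apply/esym/Lmul_eq0.
have [xT|/extend0_out->] :=
  boolP (regular (segment 0 n z) && (norm (segment 0 n z) == Some l)); last by left.
right; apply: extend0_out; apply: contra zT; case/andP: xT => xR /eqP xl.
by case/andP=> yR /eqP yk; rewrite regular_cat xR yR norm_cat xl yk /=.
Qed.

Lemma extend0_one : extend0 cochain_one = Lone K G.
Proof.
apply/ffunP => z; rewrite LoneE ffunE insubT => [|zT]; last by rewrite ffunE.
by rewrite /norm big_ord0 eqxx andbT; apply/forallP => -[].
Qed.

Lemma extend0_inj n l : injective (@extend0 n l).
Proof.
by move=> phi psi /ffunP e; apply/ffunP => x; have := e (val x);
  rewrite !extend0_val.
Qed.

Lemma extend0_linear n l : linear (@extend0 n l).
Proof.
move=> a phi psi; apply/ffunP => x; rewrite !ffunE.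
by case: insub => [y|]; rewrite ?ffunE ?scaler0 ?addr0.
Qed.
HB.instance Definition _ n l := GRing.isLinear.Build K (cochain n l)
  (freemod K (n.+1.-tuple G)) _ (@extend0 n l) (@extend0_linear n l).

Lemma cochain_diff_linear n l : linear (@cochain_diff n l).
Proof.
move=> a phi psi; apply/ffunP => x; rewrite [RHS]ffunE [in RHS]ffunE !cochain_diffE.
by rewrite linearP /Ldiff linearP !ffunE.
Qed.
HB.instance Definition _ n l := GRing.isLinear.Build K (cochain n l)
  (cochain n.+1 l) _ (@cochain_diff n l) (@cochain_diff_linear n l).

Lemma cochain_mul_bilinear n l m k : bilinear_op (@cochain_mul n l m k).
Proof.
split=> [psi a phi phi' | phi a psi psi']; apply: extend0_inj;
  rewrite linearP /= !extend0_mul linearP /=.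
  by rewrite (bilDl (@Lmul_bilinear _ _ _ _)) (bilZl (@Lmul_bilinear _ _ _ _)).
by rewrite (bilDr (@Lmul_bilinear _ _ _ _)) (bilZr (@Lmul_bilinear _ _ _ _)).
Qed.

Fact cocyclep_closed n l : subsemimod_closed (@cocyclep n l).
Proof.
split; first split.
- by rewrite inE linear0.
- by move=> f g; rewrite !inE => /eqP f0 /eqP g0; rewrite linearD /= f0 g0 addr0.
- by move=> a f; rewrite !inE => /eqP f0; rewrite linearZ /= f0 scaler0.
Qed.
HB.instance Definition _ n l := GRing.isSubmodClosed.Build K (cochain n l)
  (@cocyclep n l) (@cocyclep_closed n l).

Fact coboundaryp_closed n l : subsemimod_closed (@coboundaryp n l).
Proof.
case: n => [|n]; (split; first split).
- by rewrite inE.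
- by move=> f g; rewrite !inE => /eqP-> /eqP->; rewrite addr0.
- by move=> a f; rewrite !inE => /eqP->; rewrite scaler0.
- by apply/asboolP; exists 0; rewrite linear0.
- move=> _ _ /asboolP[f ->] /asboolP[g ->].
  by apply/asboolP; exists (f + g); rewrite linearD.
- by move=> a _ /asboolP[f ->]; apply/asboolP; exists (a *: f); rewrite linearZ.
Qed.
HB.instance Definition _ n l := GRing.isSubmodClosed.Build K (cochain n l)
  (@coboundaryp n l) (@coboundaryp_closed n l).

Definition cocycle n l : submodClosed (cochain n l) := @cocyclep n l.
Definition coboundary n l : submodClosed (cochain n l) := @coboundaryp n l.

Lemma Ldiff_extend0_mul n l m k (phi : cochain n l) (psi : cochain m k)
    (z : (n + m).+2.-tuple G) :
  regular z -> norm z = Some (l + k)%N ->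
  Ldiff (extend0 (cochain_mul phi psi)) z =
    (extend0 (cochain_diff phi) (segment 0 n.+1 z) : K)
      * extend0 psi (segment n.+1 m z)
    + (-1) ^+ n * ((extend0 phi (segment 0 n z) : K)
      * extend0 (cochain_diff psi) (segment n m.+1 z)).
Proof.
have diffT p q (chi : cochain p q) x : regular x -> norm x = Some q ->
    extend0 (cochain_diff chi) x = Ldiff (extend0 chi) x.
  move=> xR xq; have xT : regular x && (norm x == Some q) by rewrite xR xq eqxx.
  have -> : x = val (exist _ x xT : generator _ _) by [].
  by rewrite extend0_val cochain_diffE.
move=> zR zlk; rewrite extend0_mul Ldiff_mul; congr (_ + _ * _).
  have [/andP[yR /eqP yk]|/extend0_out->] :=
    boolP (regular (segment n.+1 m z) && (norm (segment n.+1 m z) == Some k));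
    last by rewrite !mulr0.
  move: zR zlk; rewrite (@regular_cat _ n.+1 m) (@norm_cat n.+1 m) yk.
  case/andP=> xR _; case xl: norm => [l'|//] [/addIn l'l].
  by rewrite diffT // xl l'l.
have [/andP[xR /eqP xl]|/extend0_out->] :=
  boolP (regular (segment 0 n z) && (norm (segment 0 n z) == Some l));
  last by rewrite !mul0r.
have e := esym (addnS n m).
pose z' : (n + m.+1).+1.-tuple G := tcast (congr1 S e) z.
have castE p s : segment s p z' = segment s p z by rewrite /z' segment_cast.
have z'R : regular z' = regular z by exact: regular_cast.
have z'n : norm z' = norm z by exact: norm_cast.
move: zR zlk; rewrite -z'R -z'n regular_cat norm_cat !castE xl.
case/andP=> _ yR; case yk: norm => [k'|//] [/addnI k'k].
by rewrite diffT // yk k'k.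
Qed.

Lemma coboundary_intro n N l (e : N = n.+1) (phi : cochain N l)
    (psi : cochain n l) :
  (forall z, regular z -> norm z = Some l ->
     extend0 phi z = Ldiff (extend0 psi) (tcast (congr1 S e) z)) ->
  phi \in coboundary N l.
Proof.
subst N => h; apply/asboolP; exists psi; apply/ffunP => x.
have /andP[xR /eqP xl] := valP x.
by rewrite cochain_diffE -extend0_val h // tcast_id.
Qed.

Lemma cochain_mul_compatible n l m k :
  compatible (cocycle n l) (coboundary n l) (cocycle m k) (coboundary m k)
    (cocycle (n + m) (l + k)) (coboundary (n + m) (l + k))
    (@cochain_mul n l m k).
Proof.
split=> phi psi.
- rewrite !inE => /eqP phi0 /eqP psi0; apply/eqP/ffunP => x.
  have /andP[xR /eqP xl] := valP x; rewrite cochain_diffE Ldiff_extend0_mul //.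
  by rewrite phi0 psi0 !linear0 !freemod0 mul0r !mulr0 addr0.
- case: n phi => [|n] phi.
    rewrite inE => /eqP-> _; rewrite (bil0l (@cochain_mul_bilinear _ _ _ _)).
    exact: (@rpred0 _ (coboundary _ _)).
  move=> /asboolP[chi ->]; rewrite inE => /eqP psi0.
  apply: (@coboundary_intro (n + m) (n.+1 + m) _ erefl _ (cochain_mul chi psi)).
  move=> z zR zl; rewrite tcast_id Ldiff_extend0_mul // psi0 linear0 freemod0.
  by rewrite !mulr0 addr0 extend0_mul LmulE.
case: m psi => [|m] psi.
  move=> _; rewrite inE => /eqP->; rewrite (bil0r (@cochain_mul_bilinear _ _ _ _)).
  exact: (@rpred0 _ (coboundary _ _)).
rewrite inE => /eqP phi0 /asboolP[chi ->].
apply: (@coboundary_intro _ _ _ (addnS n m) _ ((-1) ^+ n *: cochain_mul phi chi)).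
move=> z zR zl; rewrite linearZ /= /Ldiff linearZ /= [RHS]ffunE -/(Ldiff _).
set z' := tcast _ _.
have z'R : regular z' by rewrite regular_cast.
have z'l : norm z' = Some (l + k)%N by rewrite norm_cast.
rewrite Ldiff_extend0_mul // phi0 linear0 freemod0 mul0r add0r [_ *: _]signrMK.
by rewrite extend0_mul LmulE !segment_cast.
Qed.

Definition MH n l : lmodType K := subquot (cocycle n l) (coboundary n l).

Definition MHmul n l m k : MH n l -> MH m k -> MH (n + m) (l + k) :=
  induced_mul (@cochain_mul_compatible n l m k).

Fact cochain_one_cocycle : cochain_one \in cocycle 0 0.
Proof.
rewrite inE; apply/eqP/ffunP => x.
rewrite cochain_diffE extend0_one LdiffE !big_ord_recl big_ord0 !LoneE.
by rewrite expr0 expr1 mul1r mulr1 addr0 subrr ffunE.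
Qed.

Definition MHone : MH 0 0 :=
  class (coboundary 0 0) (Submod cochain_one_cocycle).

Lemma extend0_cast n m (e : n = m) (phi : cochain n n) :
  extend0 (ecast i (cochain i i) e phi) =
  ecast i (freemod K (i.+1.-tuple G)) e (extend0 phi).
Proof. by case: m / e. Qed.

Fact diag_mul1x n (phi : cochain n n) : cochain_mul cochain_one phi = phi.
Proof. by apply: extend0_inj; rewrite extend0_mul extend0_one Lmul1x. Qed.

Fact diag_mulx1 n (phi : cochain n n) :
  ecast i (cochain i i) (addn0 n) (cochain_mul phi cochain_one) = phi.
Proof.
by apply: extend0_inj; rewrite extend0_cast extend0_mul extend0_one Lmulx1.
Qed.

Fact diag_mulA n m p (phi : cochain n n) (psi : cochain m m)
    (chi : cochain p p) :
  ecast i (cochain i i) (addnA n m p) (cochain_mul phi (cochain_mul psi chi)) =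
  cochain_mul (cochain_mul phi psi) chi.
Proof. by apply: extend0_inj; rewrite extend0_cast !extend0_mul LmulA. Qed.

Definition MCdiag : gradedAlg K :=
  @GradedAlg K (fun n => cochain n n) cochain_one
    (fun n m => @cochain_mul n n m m)
    (fun n m => @cochain_mul_bilinear n n m m)
    diag_mul1x diag_mulx1 diag_mulA.

(* Only used for its proofs of the algebra laws. *)
Definition MHdiag_laws : gradedAlg K :=
  @graded_subquot K MCdiag (fun n => cocycle n n) (fun n => coboundary n n)
    cochain_one_cocycle (fun n m => @cochain_mul_compatible n n m m).

Definition MHdiag : gradedAlg K :=
  @GradedAlg K (fun n => MH n n) MHone (fun n m => @MHmul n n m m)
    (@gmul_bilinear K MHdiag_laws) (@gmul1x K MHdiag_laws)
    (@gmulx1 K MHdiag_laws) (@gmulA K MHdiag_laws).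

End MagnitudeCochains.

(* Main.v *)
From HB Require Import structures.
Require Import Defs.
From mathcomp Require Import all_boot all_order all_algebra.
From mathcomp Require Import boolp.

(** Restricting a cochain of R^n to the paths of length n gives the
    isomorphism.

    Distinct vertices are at distance at least 1, and at distance 1 exactly
    when they are joined by an arrow.  So a regular n-step tuple has norm at
    least n, and norm n exactly when it is a path: MC^{n,n} consists of the
    functions on paths of length n, and MC^{n+1,n} = 0, so that every cochain
    of MC^{n,n} is a cocycle.  Hence the restriction R^n -> MC^{n,n} is onto
    the cocycles, with kernel N^n ([restrict_eq0]).

    It remains to see that the boundaries of N^p restrict to the coboundaries
    of MC^{p,p+1} ([restrict_coboundary]).  Deleting one vertex of a path of
    length p + 1 replaces at most one step by a step of length at most 2, so
    the norm of what is left is at most p + 1 ([norm_delete_path]).  A face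
    that is regular and not a path therefore has norm exactly p + 1
    ([norm_face_path]): when evaluated on paths, the boundary of b in N^p only
    sees the values of b on the generators of MC^{p,p+1}, where it is the
    magnitude coboundary.

    Both products are given by the same formula, and both segments of a path
    are paths, so the restriction is multiplicative. *)

Set Implicit Arguments.
Unset Strict Implicit.
Unset Printing Implicit Defensive.

Import GRing.Theory.
Local Open Scope ring_scope.

(** * Isomorphisms between subquotients *)

Section InducedMap.
Variables (K : pzRingType) (V W : lmodType K).
Variables (Z B : submodClosed V) (Z' B' : submodClosed W).
Variable phi : {linear V -> W}.
Hypothesis phiP :
  {in Z, forall x, phi x \in Z' /\ (phi x \in B') = (x \in B)}.

Let phiB x : x \in Z -> (phi x \in B') = (x \in B).
Proof. by case/phiP. Qed.

Fact induced_map_subproof (z : submod Z) : phi (val z) \in Z'.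
Proof. by have [] := phiP (valP z). Qed.

Definition induced_map (x : subquot Z B) : subquot Z' B' :=
  class B' (Submod (induced_map_subproof (repr x))).

Lemma induced_mapE z :
  induced_map (class B z) = class B' (Submod (induced_map_subproof z)).
Proof.
apply/eqP; rewrite eq_class /= -linearB phiB ?repr_class //.
by apply: submodB; apply: valP.
Qed.

Fact induced_map_linear : linear induced_map.
Proof.
move=> a x y; have [[z ->] [w ->]] := (classP x, classP y).
rewrite -linearP !induced_mapE -linearP; congr (class _ _); apply: val_inj.
by rewrite /= linearP.
Qed.
HB.instance Definition _ :=
  GRing.isLinear.Build K (subquot Z B) (subquot Z' B') _ induced_map
    induced_map_linear.

(** The equality of booleans in [phiP] makes the induced map injective,
    and a section of phi with values in Z provides the inverse. *)
Lemma induced_map_bij (psi : W -> V) :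
  cancel psi phi -> {in Z', forall y, psi y \in Z} -> bijective induced_map.
Proof.
move=> psiK psiZ.
pose lift (w : submod Z') := Submod (psiZ _ (valP w)).
exists (fun y => class B (lift (repr y))) => [x | y]; last first.
  have [w ->] := classP y; rewrite induced_mapE; apply/eqP.
  by rewrite eq_class /= psiK repr_class.
have [z ->] := classP x; rewrite induced_mapE; apply/eqP.
rewrite eq_class /= -phiB; last by apply: submodB; [exact/psiZ/valP | exact: valP].
by rewrite linearB psiK repr_class.
Qed.

End InducedMap.

(** * Distances and norms *)

Section Norm.
Variable G : digraph.
Implicit Types (u v : G) (n p : nat).

Lemma joined0 u v : joined u v 0 = (u == v).
Proof.
apply/existsP/eqP => [[x /and3P[_ /eqP <- /eqP <-]] // | <-].
exists [tuple u | i < 1]; rewrite vtx_mktuple eqxx !andbT.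
by apply/forallP => -[].
Qed.

Lemma joined1 u v : joined u v 1 = arrow u v.
Proof.
apply/existsP/idP => [[x /and3P[/forallP/(_ ord0) xP /eqP <- /eqP <-]] // | uv].
exists [tuple if val i == 0%N then u else v | i < 2].
rewrite !vtx_mktuple /= !inordK //= !eqxx !andbT.
by apply/forallP => -[[|//] i1] /=; rewrite !vtx_mktuple /= !inordK.
Qed.

Lemma joined2 u v w : arrow u v -> arrow v w -> joined u w 2.
Proof.
move=> uv vw; apply/existsP.
exists [tuple if val i == 0%N then u else if val i == 1%N then v else w | i < 3].
rewrite !vtx_mktuple /= !inordK //= !eqxx !andbT.
by apply/forallP => -[[|[|//]] i2] /=; rewrite !vtx_mktuple /= !inordK.
Qed.

Lemma dist_joined u v k : dist u v = Some k -> joined u v k.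
Proof.
by rewrite /dist; case: pselect => // ex [<-]; case: ex_minnP.
Qed.

Lemma dist_le u v k : joined u v k -> exists2 l, dist u v = Some l & (l <= k)%N.
Proof.
move=> uvk; rewrite /dist; case: pselect => [ex | []]; last by exists k.
by exists (ex_minn ex) => //; case: ex_minnP => m _; apply.
Qed.

Lemma dist_gt0 u v k : u != v -> dist u v = Some k -> (0 < k)%N.
Proof. by case: k => // uv /dist_joined; rewrite joined0 (negPf uv). Qed.

Lemma arrow_neq u v : arrow u v -> u != v.
Proof. by apply: contraL => /eqP->; rewrite arrow_irrefl. Qed.

Lemma dist_arrow u v : arrow u v -> dist u v = Some 1%N.
Proof.
move=> uv; have := uv; rewrite -joined1 => /dist_le[k uvk].
by have := dist_gt0 (arrow_neq uv) uvk; case: k uvk => [|[]].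
Qed.

Lemma norm_sum n (x : n.+1.-tuple G) (F : 'I_n -> nat) :
  (forall i : 'I_n, dist (vtx x i) (vtx x i.+1) = Some (F i)) ->
  norm x = Some (\sum_i F i)%N.
Proof.
move=> xF; rewrite /norm (eq_bigr (fun i => Some (F i))); last by move=> i _.
by symmetry; apply: (big_morph (fun k => Some k)).
Qed.

Lemma norm_steps n (x : n.+1.-tuple G) l : norm x = Some l ->
  exists2 F : 'I_n -> nat, l = (\sum_i F i)%N
    & forall i : 'I_n, dist (vtx x i) (vtx x i.+1) = Some (F i).
Proof.
move=> xl; pose F (i : 'I_n) := odflt 0%N (dist (vtx x i) (vtx x i.+1)).
have xF (i : 'I_n) : dist (vtx x i) (vtx x i.+1) = Some (F i).
  rewrite /F; case xi: dist => [//|]; move: xl.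
  by rewrite /norm (bigD1 i) //= xi.
by exists F => //; move: xl; rewrite (norm_sum xF) => -[].
Qed.

Lemma path_regular n (x : n.+1.-tuple G) : is_path x -> regular x.
Proof. by move/forallP=> xP; apply/forallP => i; apply/arrow_neq/xP. Qed.

Lemma norm_path n (x : n.+1.-tuple G) : is_path x -> norm x = Some n.
Proof.
move=> /forallP xP; rewrite (@norm_sum _ _ (fun=> 1%N)).
  by rewrite sum1_card card_ord.
by move=> i; apply/dist_arrow/xP.
Qed.

Lemma norm_ge n (x : n.+1.-tuple G) l :
  regular x -> norm x = Some l -> (n <= l)%N.
Proof.
move=> /forallP xR /norm_steps[F -> xF].
rewrite -{1}[n]card_ord -sum1_card; apply: leq_sum => i _.
exact: dist_gt0 (xR i) (xF i).
Qed.

(** A regular tuple of minimal norm has all its steps of length 1, by the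
    equality case of a sum of inequalities. *)
Lemma norm_eq_path n (x : n.+1.-tuple G) :
  regular x && (norm x == Some n) = is_path x.
Proof.
apply/andP/idP => [[/forallP xR /eqP] | xP]; last first.
  by rewrite path_regular // norm_path.
move=> /norm_steps[F nF xF]; apply/forallP => i.
suff Fi : F i = 1%N by rewrite -joined1; apply: dist_joined; rewrite xF Fi.
have F1 j : true -> (1 <= F j ?= iff (F j == 1))%N.
  move=> _; split; first exact: dist_gt0 (xR j) (xF j).
  by rewrite eq_sym.
have := leqif_sum F1; rewrite sum1_card card_ord -nF => -[_ /esym].
by rewrite eqxx => /forallP/(_ i)/eqP.
Qed.

(** The step of length at most 2 is the one that jumps over the deleted
    vertex; there is none when that vertex is an end of the path. *)
Lemma norm_delete_path p (i : 'I_p.+2) (z : p.+2.-tuple G) : is_path z ->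
  exists2 l, norm (delete i z) = Some l & (l <= p.+1)%N.
Proof.
move=> /vtx_allP zP; set w := delete i z.
have step (j : 'I_p) : exists2 l,
    dist (vtx w j) (vtx w j.+1) = Some l & (l <= 1 + (j.+1 == i))%N.
  have jp := ltn_ord j; rewrite !vtx_delete //; last exact: ltnW.
  have [ltji | ltij | eqji] := ltngtP j.+1 i.
  - rewrite /bump !(leqNgt i) ltji (ltn_trans _ ltji) //=.
    by exists 1%N => //; apply/dist_arrow/zP/ltnW.
  - rewrite /bump -ltnS ltij (ltnW ltij) !add1n.
    by exists 1%N => //; apply/dist_arrow/zP.
  - rewrite /bump -eqji leqnn ltnn add0n add1n.
    by apply/dist_le/(joined2 (v := vtx z j.+1)); apply: zP => //; apply: ltnW.
pose F (j : 'I_p) := odflt 0%N (dist (vtx w j) (vtx w j.+1)).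
exists (\sum_j F j)%N.
  by apply: norm_sum => j; rewrite /F; have [l -> _] := step j.
apply: (@leq_trans (\sum_(j < p) (1 + (j.+1 == i)))%N).
  by apply: leq_sum => j _; rewrite /F; have [l -> ?] := step j.
rewrite big_split /= sum1_card card_ord.
apply: (@leq_trans (p + 1)); last by rewrite addn1.
rewrite leq_add2l.
rewrite -big_mkcond /= sum1_card; apply/card_le1_eqP => j k.
by move=> /eqP ji /eqP ki; apply/val_inj/succn_inj; rewrite ji ki.
Qed.

Lemma norm_face_path p (i : 'I_p.+2) (z : p.+2.-tuple G) : is_path z ->
  regular (delete i z) -> ~~ is_path (delete i z) ->
  norm (delete i z) = Some p.+1.
Proof.
move=> zP wR; rewrite -norm_eq_path wR.
have [l wl le_lp] := norm_delete_path i zP; rewrite wl => nlp.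
congr Some; apply/eqP; rewrite eqn_leq le_lp ltn_neqAle (norm_ge wR wl) andbT.
by apply: contra nlp => /eqP->; rewrite eqxx.
Qed.

End Norm.

(** * Restriction to generators *)

Section Restriction.
Variables (K : comPzRingType) (G : digraph).
Local Notation Lambda n := (freemod K (n.+1.-tuple G)).

Definition restrict n l (f : Lambda n) : cochain K G n l :=
  [ffun x : generator G n l => f (val x)].

Fact restrict_linear n l : linear (@restrict n l).
Proof. by move=> a f g; apply/ffunP => x; rewrite !ffunE. Qed.
HB.instance Definition _ n l := GRing.isLinear.Build K (Lambda n)
  (cochain K G n l) _ (@restrict n l) (@restrict_linear n l).

Lemma extend0K n l : cancel (@extend0 K G n l) (@restrict n l).
Proof. by move=> phi; apply/ffunP => x; rewrite ffunE extend0_val. Qed.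

Lemma extend0_R n l (phi : cochain K G n l) : extend0 phi \in Rsub K G n.
Proof.
by apply/spanP => x /negPf xR; apply: extend0_out; rewrite xR.
Qed.

Lemma restrict_eq0 n (f : Lambda n) : f \in Rsub K G n ->
  (restrict n f == 0) = (f \in Nsub K G n).
Proof.
move=> /spanP Rf; apply/eqP/spanP => [/ffunP f0 x | Nf].
  rewrite negb_and negbK => /orP[/Rf //|]; rewrite -norm_eq_path => xT.
  by have := f0 (exist _ x xT); rewrite !ffunE.
apply/ffunP => x; rewrite !ffunE; apply: Nf.
by have := valP x; rewrite norm_eq_path => ->; rewrite andbF.
Qed.

(** No tuple of n + 1 nontrivial steps has norm n, so the coboundary has
    nowhere to be nonzero. *)
Lemma cochain_diag_cocycle n (phi : cochain K G n n) :
  phi \in cocycle K G n n.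
Proof.
rewrite inE; apply/eqP/ffunP => x.
by have /andP[xR /eqP /(norm_ge xR)] := valP x; rewrite ltnn.
Qed.

Lemma extend0_N p (psi : cochain K G p p.+1) : extend0 psi \in Nsub K G p.
Proof.
apply/spanP => x; rewrite negb_and negbK => /orP[/negPf xR | /norm_path xp].
  by apply: extend0_out; rewrite xR.
by apply: extend0_out; rewrite xp; apply/negP => /andP[_ /eqP[/n_Sn]].
Qed.

(** The faces of a path that are not generators of MC^{p,p+1} are irregular
    or paths, and b vanishes on both. *)
Lemma restrict_Ldiff p (b : Lambda p) : b \in Nsub K G p ->
  restrict p.+1 (Ldiff b) = cochain_diff (restrict p.+1 b).
Proof.
move=> /spanP Nb; apply/ffunP => x; rewrite ffunE cochain_diffE !LdiffE.
have := valP x; rewrite norm_eq_path => xP.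
apply: eq_bigr => i _; congr (_ * _); set w := delete i (val x).
have [wT | wT] := boolP (regular w && (norm w == Some p.+1)).
  have -> : w = val (exist _ w wT : generator G p p.+1) by [].
  by rewrite extend0_val ffunE.
rewrite extend0_out // Nb //; apply: contra wT => /andP[wR wP].
by rewrite wR (norm_face_path xP) ?eqxx.
Qed.

(** By [restrict_Ldiff] an element a + Ldiff b of J restricts to the coboundary
    of the restriction of b.  Conversely, if f restricts to the coboundary of
    psi, the extension of psi by zero lies in N, and f differs from its
    boundary by an element of the kernel N of the restriction. *)
Lemma restrict_coboundary n (f : Lambda n) : f \in Rsub K G n ->
  (restrict n f \in coboundary K G n n) = (f \in Jsub K G n).
Proof.
case: n f => [|p] f Rf; first by rewrite inE restrict_eq0.
apply/asboolP/asboolP => [[psi fE] | [a [b [Na Nb ->]]]].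
  have Nb := extend0_N psi.
  exists (f - Ldiff (extend0 psi)), (extend0 psi); split=> //; last by rewrite subrK.
  rewrite -restrict_eq0; last by apply: submodB => //; apply/Ldiff_R/Nsub_R.
  by rewrite linearB /= fE restrict_Ldiff // extend0K subrr.
exists (restrict p.+1 b); rewrite linearD /= -restrict_Ldiff //.
have := Nsub_R Na => /restrict_eq0; rewrite Na => /eqP->.
by rewrite add0r.
Qed.

Lemma restrict_one : restrict 0 (Lone K G) = cochain_one K G.
Proof. by apply/ffunP => x; rewrite !ffunE LoneE. Qed.

Lemma restrict_mul n m (f : Lambda n) (g : Lambda m) :
  restrict (n + m) (Lmul f g) = cochain_mul (restrict n f) (restrict m g).
Proof.
apply/ffunP => x; rewrite !ffunE LmulE.
have := valP x; rewrite norm_eq_path is_path_cat -!norm_eq_path => /andP[xT yT].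
by rewrite !insubT !ffunE.
Qed.

End Restriction.

(** * The isomorphism *)

Theorem corollary5p5 (K : comPzRingType) (G : digraph) :
  graded_iso (Omega K G) (MHdiag K G).
Proof.
have restrictP n : {in Rsub K G n, forall f,
    restrict n f \in cocycle K G n n
    /\ (restrict n f \in coboundary K G n n) = (f \in Jsub K G n)}.
  by move=> f Rf; rewrite cochain_diag_cocycle restrict_coboundary.
pose F n : {linear Omega K G n -> MHdiag K G n} := induced_map (@restrictP n).
pose J k := Jsub K G k; pose B k := coboundary K G k k.
have FE k u : F k (class (J k) u) =
    class (B k) (Submod (induced_map_subproof (@restrictP k) u)).
  exact: induced_mapE.
exists F; split=> [n | | n m x y].
- apply: (induced_map_bij (@restrictP n) (@extend0K K G n n)) => phi _.
  exact: extend0_R.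
- rewrite [gone _]/(class (J 0%N) _) FE.
  by apply: (congr1 (class (B 0%N))); apply: val_inj; apply: restrict_one.
have [[z ->] [w ->]] := (classP x, classP y).
have OmegaM : @gmul _ (Omega K G) n m (class (J n) z) (class (J m) w) =
    class (J (n + m)%N) (Submod (induced_subproof (@Lmul_compatible K G n m) z w)).
  exact: (induced_mulE (@Lmul_compatible K G n m) (@Lmul_bilinear K G n m)).
have MHM u v : @gmul _ (MHdiag K G) n m (class (B n) u) (class (B m) v) =
    class (B (n + m)%N)
      (Submod (induced_subproof (@cochain_mul_compatible K G n n m m) u v)).
  exact: (induced_mulE _ (@cochain_mul_bilinear K G n n m m)).
rewrite OmegaM !FE MHM.
apply: (congr1 (class (B (n + m)%N))); apply: val_inj; exact: restrict_mul.
Qed.
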